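(* For every $\varepsilon>0$ there is an $\eta>0$ such that for all sufficiently large $n$ the following holds: if $\mathcal{F}$ is a maximal $3$-wise intersecting family of subsets of $[n]$ with $|\mathcal{F}| \le (1+\eta)2^{(n+2)/2}$, then $n$ is even and there is a balanced pair of linked cubes $\mathcal{L}$ over $[n]$ such that all but at most $\varepsilon|\mathcal{F}|$ members of $\mathcal{F}$ belong to $\mathcal{L}$.
   Context: A family $\mathcal{F}$ of subsets of $[n]=\{1,\ldots,n\}$ is $k$-wise intersecting if every collection of at most $k$ members of $\mathcal{F}$ has a common element; it is maximal $k$-wise intersecting if moreover no subset of $[n]$ outside $\mathcal{F}$ can be added to $\mathcal{F}$ while preserving this property. A pair of linked cubes is a family of the form $\{A : S \subsetneq A \subseteq [n]\} \cup \{B : [n]\setminus S \subsetneq B \subseteq [n]\}$ for some $S \subseteq [n]$; it is balanced if $\lfloor n/2\rfloor \le |S| \le \lceil n/2 \rceil$. *)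

(* Defs.v *)
From mathcomp Require Import all_boot.
From Stdlib Require Import Reals.
Set Implicit Arguments. Unset Strict Implicit. Unset Printing Implicit Defensive.

Definition kwise_intersecting (n k : nat) (F : {set {set 'I_n}}) : Prop :=
  forall G : {set {set 'I_n}}, G \subset F -> (0 < #|G| <= k)%N ->
    exists x : 'I_n, forall A, A \in G -> x \in A.

Definition maximal_kwise_intersecting (n k : nat) (F : {set {set 'I_n}}) : Prop :=
  kwise_intersecting k F /\
  forall A : {set 'I_n}, A \notin F -> ~ kwise_intersecting k (A |: F).

Definition linked_cubes (n : nat) (S : {set 'I_n}) : {set {set 'I_n}} :=
  [set A : {set 'I_n} | S \proper A] :|: [set B : {set 'I_n} | (~: S) \proper B].

Definition balanced (n : nat) (S : {set 'I_n}) : Prop :=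
  (n./2 <= #|S| <= uphalf n)%N.

(* Main.v *)
Require Import Defs.
From mathcomp Require Import zify.
From Stdlib Require Import Reals Lra.
From mathcomp Require Import all_boot.
Set Implicit Arguments. Unset Strict Implicit. Unset Printing Implicit Defensive.
(* [zify] loads [ring_scope], which takes over the key [%R]. *)
Delimit Scope R_scope with R.

(** Let [G] be the family of complements of members of [F], with [m] members.
    By maximality [F] is an up-set and every set outside [F] is a disjoint union
    of two members of [G], so the disjointness graph on [G] has at least
    [2^n - m], that is almost [m^2 / 4], edges. It has [o(m^3)] triangles, by a
    blow-up argument in the style of Alon and Frankl. Hence for some edge [AB]
    the neighbourhoods [X] of [A] and [Y] of [B] almost partition [G], contain few
    edges, and almost every pair in [X * Y] is disjoint. Each element of [n] must
    be frequent in [X] or in [Y], since half of all sets contain it; as an element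
    frequent in [X] belongs to few members of [Y], the set [S] of elements frequent
    in [X] satisfies: almost all of [X] lies below [S] and almost all of [Y] below
    its complement. Then [2^|S| + 2^(n-|S|)] is at most about [2 * 2^(n/2)],
    which forces [|S| = n/2].

    All estimates are kept in [nat] by clearing denominators: [c] stands for the
    inverse of the error parameter and [100 * c] for that of [eta] (up to a factor). *)

(** * Power means and counting of tuples *)

(** Summing the rearrangement inequality for [f i] and [f j] over all ordered pairs gives twice the
    claim. *)
Lemma chebyshev_sum (I : finType) (A : {pred I}) (f : I -> nat) (t : nat) :
  (\sum_(i in A) f i) * (\sum_(i in A) f i ^ t)
    <= #|A| * \sum_(i in A) f i ^ t.+1.
Proof.
have rearr a b : a * b ^ t + b * a ^ t <= a ^ t.+1 + b ^ t.+1.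
  wlog le_ab : a b / a <= b.
    by move=> H; case/orP: (leq_total a b) => /H //; rewrite addnC [X in _ <= X]addnC.
  have le_t : a ^ t <= b ^ t by case: (t) => // s; rewrite leq_exp2r.
  by rewrite !expnS; nia.
pose T1 := \sum_(i in A) \sum_(j in A) f i * f j ^ t.
pose T2 := \sum_(i in A) \sum_(j in A) f j * f i ^ t.
pose T3 := \sum_(i in A) \sum_(j in A) f i ^ t.+1.
pose T4 := \sum_(i in A) \sum_(j in A) f j ^ t.+1.
have e12 : T2 = T1 by rewrite /T1 /T2 exchange_big.
have e34 : T3 = T4 by rewrite /T3 /T4 exchange_big.
have e4 : T4 = #|A| * \sum_(i in A) f i ^ t.+1 by rewrite /T4 sum_nat_const.
have le : T1 + T2 <= T3 + T4.
  by rewrite /T1 /T2 /T3 /T4 -!big_split; apply: leq_sum => i _;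
     rewrite -!big_split; apply: leq_sum => j _; apply: rearr.
by rewrite big_distrlr /= -/T1; lia.
Qed.

Lemma power_mean (I : finType) (A : {pred I}) (f : I -> nat) (t : nat) :
  (\sum_(i in A) f i) ^ t.+1 <= #|A| ^ t * \sum_(i in A) f i ^ t.+1.
Proof.
elim: t => [|t IH]; first by rewrite expn1 mul1n.
rewrite expnS (leq_trans (leq_mul (leqnn _) IH)) // mulnCA [#|A| ^ t.+1]expnSr -mulnA.
by rewrite leq_mul2l chebyshev_sum orbT.
Qed.

Lemma card_pair_dep (I J : finType) (A : {set I}) (B : I -> {set J}) :
  #|[set p : I * J | (p.1 \in A) && (p.2 \in B p.1)]| = \sum_(i in A) #|B i|.
Proof.
rewrite -sum1_card; under [RHS]eq_bigr do rewrite -sum1_card.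
by rewrite pair_big_dep; apply: eq_bigl => p; rewrite inE.
Qed.

(** [#|P x| ^ t.+1] counts the tuples with all entries in [P x]; after the power mean inequality the
    two sums are exchanged. *)
Lemma blow_up (I J : finType) (X : {set I}) (P : I -> {set J}) (t : nat) :
  (\sum_(x in X) #|P x|) ^ t.+1 <=
  #|X| ^ t * \sum_(a : {ffun 'I_t.+1 -> J}) #|[set x in X | [forall i, a i \in P x]]|.
Proof.
apply: leq_trans (power_mean _ _ _) _; rewrite leq_mul2l; apply/orP; right.
have -> : \sum_(x in X) #|P x| ^ t.+1 =
    \sum_(x in X) \sum_(a : {ffun 'I_t.+1 -> J} | [forall i, a i \in P x]) 1.
  apply: eq_bigr => x _; rewrite sum1_card -[in LHS](card_ord t.+1) -card_ffun_on.
  by apply: eq_card => a; rewrite unfold_in.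
rewrite (exchange_big_dep predT) //=; apply: leq_sum => a _.
rewrite -sum1_card [X in _ <= X](eq_bigl (fun x => (x \in X) && [forall i, a i \in P x])) //.
by move=> x; rewrite inE.
Qed.

Lemma card_sets_ord (n : nat) : #|{set 'I_n}| = 2 ^ n.
Proof. by rewrite -cardsT -powersetT card_powerset cardsT card_ord. Qed.

(** Each point of [W] lies in the first set, in the second or in neither; [ord0] codes neither and
    is also the value off [W]. *)
Lemma card_disjoint_pairs (T : finType) (W : {set T}) :
  #|[set p : {set T} * {set T} | [&& p.1 \subset W, p.2 \subset W & [disjoint p.1 & p.2]]]|
    <= 3 ^ #|W|.
Proof.
pose code (p : {set T} * {set T}) : {ffun T -> 'I_3} :=
  [ffun x => if x \in p.1 then inord 1 else if x \in p.2 then inord 2 else ord0].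
rewrite -[3 in X in _ <= X](card_ord 3) -(card_pffun_on ord0).
have v1 : (inord 1 : 'I_3) = 1 :> nat by rewrite inordK.
have v2 : (inord 2 : 'I_3) = 2 :> nat by rewrite inordK.
set D := [set p | _].
rewrite -(card_in_imset (f := code) (D := D)); last first.
  move=> [A B] [A' B']; rewrite !inE /= => /and3P[_ _ d] /and3P[_ _ d'] e.
  have h x : (x \in A) = (x \in A') /\ (x \in B) = (x \in B').
    move/ffunP/(_ x): e; rewrite !ffunE /= => /(congr1 val) /=.
    have := disjointFr d (x := x); have := disjointFr d' (x := x).
    case: (x \in A); case: (x \in A'); case: (x \in B); case: (x \in B') => //= h1 h2;
      rewrite ?v1 ?v2 //; by [have := h1 isT | have := h2 isT].
  by congr pair; apply/setP => x; case: (h x).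
apply: subset_leq_card; apply/subsetP => c /imsetP[[A B]]; rewrite inE /= => /and3P[sA sB _] ->.
apply/pffun_onP; split=> //; apply/subsetP => x; rewrite inE ffunE /=.
case: ifP => [/(subsetP sA) //|_]; case: ifP => [/(subsetP sB) //|_].
by rewrite eqxx.
Qed.

(** * Averaging over the edges of a graph *)

Definition neighbours (V : finType) (adj : rel V) (G : {set V}) (A : V) : {set V} :=
  [set C in G | adj A C].

(** Ordered pairs are counted: for symmetric [adj] and [X] inside [G], an edge between distinct
    vertices counts twice, a loop (such as [set0] under disjointness) once. [triangles] likewise
    counts ordered triples. *)
Definition inner_edges (V : finType) (adj : rel V) (G X : {set V}) : nat :=
  \sum_(B in X) #|X :&: neighbours adj G B|.

Definition triangles (V : finType) (adj : rel V) (G : {set V}) : nat :=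
  \sum_(A in G) inner_edges adj G (neighbours adj G A).

Lemma sum_neighboursC (V : finType) (adj : rel V) (G : {set V}) (f : V -> V -> nat) :
  symmetric adj ->
  \sum_(A in G) \sum_(B in neighbours adj G A) f A B =
  \sum_(A in G) \sum_(B in neighbours adj G A) f B A.
Proof.
move=> sym; rewrite (exchange_big_dep (mem G)) /=; last by move=> i j _; rewrite inE => /andP[].
by apply: eq_bigr => B BG; apply: eq_bigl => A; rewrite !inE BG sym.
Qed.

(* Averaging over the edges: since [\sum_(edges) (deg A + deg B) = 2 \sum deg^2],
   Cauchy-Schwarz makes the average of [deg A + deg B] almost [m], while the
   other quantities are sums over triangles. *)
Lemma exists_spanning_edge (V : finType) (adj : rel V) (G : {set V}) (L : nat) :
  symmetric adj ->
  let m := #|G| in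
  let N := neighbours adj G in
  let E := \sum_(A in G) #|N A| in
  L * (4 * (m * triangles adj G)) + L * (m ^ 2 * E) < L * (2 * E ^ 2) + m ^ 2 * E ->
  exists A B, [/\ A \in G, B \in N A &
    L * m ^ 2 + L * (2 * (m * #|N A :&: N B|)
       + inner_edges adj G (N A) + inner_edges adj G (N B))
    <= L * (m * (#|N A| + #|N B|)) + m ^ 2].
Proof.
move=> sym m N E lt.
pose lhs A B := L * m ^ 2 + L * (2 * (m * #|N A :&: N B|)
       + inner_edges adj G (N A) + inner_edges adj G (N B)).
pose rhs A B := L * (m * (#|N A| + #|N B|)) + m ^ 2.
case: (boolP [exists A in G, exists B in N A, lhs A B <= rhs A B]) => [|none].
  by case/exists_inP => A AG /exists_inP[B BN le]; exists A, B.
exfalso.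
pose D := [set p : V * V | (p.1 \in G) && (p.2 \in N p.1)].
(* The failing inequality is summed in weak form only; the strictness needed for the contradiction
   comes from the hypothesis. *)
have le : \sum_(p in D) rhs p.1 p.2 <= \sum_(p in D) lhs p.1 p.2.
  apply: leq_sum => -[A B]; rewrite inE /= => /andP[AG BN]; apply: ltnW; rewrite ltnNge.
  apply: contra none => h; apply/exists_inP; exists A => //.
  by apply/exists_inP; exists B.
have sumD (f : V -> V -> nat) :
    \sum_(p in D) f p.1 p.2 = \sum_(A in G) \sum_(B in N A) f A B.
  by rewrite pair_big_dep; apply: eq_bigl => p; rewrite inE.
have left_sum (f : V -> nat) : \sum_(p in D) f p.1 = \sum_(A in G) #|N A| * f A.
  rewrite (sumD (fun A _ => f A)).
  by apply: eq_bigr => A _; rewrite sum_nat_const.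
have right_sum (f : V -> nat) : \sum_(p in D) f p.2 = \sum_(A in G) #|N A| * f A.
  by rewrite (sumD (fun _ B => f B)) (sum_neighboursC _ (fun _ B => f B)) // -sumD left_sum.
have cst c : \sum_(p in D) c = E * c by rewrite sum_nat_const card_pair_dep.
have tri : \sum_(p in D) #|N p.1 :&: N p.2| = triangles adj G.
  by rewrite (sumD (fun A B => #|N A :&: N B|)).
have degs := left_sum (fun A => #|N A|).
have degs' := right_sum (fun A => #|N A|).
have inn := left_sum (fun A => inner_edges adj G (N A)).
have inn' := right_sum (fun A => inner_edges adj G (N A)).
rewrite /lhs /rhs !big_split /= -!big_distrr /= !big_split /= -!big_distrr /= in le.
rewrite !cst degs degs' inn inn' tri in le.
set D2 := \sum_(A in G) _ * #|_| in le.
set D3 := \sum_(A in G) _ * inner_edges _ _ _ in le.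
have cs : E ^ 2 <= m * D2.
  have := power_mean (mem G) (fun A => #|N A|) 1; rewrite expn1.
  by congr (_ <= _ * _); apply: eq_bigr => A _; rewrite expnS expn1.
have tr : D3 <= m * triangles adj G.
  rewrite /D3 /triangles big_distrr; apply: leq_sum => A _; rewrite leq_mul2r.
  by apply/orP; right; apply: subset_leq_card; apply/subsetP => C; rewrite inE => /andP[].
have csL := leq_mul (leqnn L) cs; have trL := leq_mul (leqnn L) tr.
by lia.
Qed.

(** * Few triangles in the disjointness graph *)

(** [27 * 7 <= 32 * 6] gives [32 / 27 >= 7 / 6], and Bernoulli gives [(7 / 6) ^ n >= 1 + n / 6]. *)
Lemma geometric_gap (c n : nat) : 6 * c <= n -> c * 27 ^ n <= 32 ^ n.
Proof.
move=> le.
have bernoulli : (6 + n) * 6 ^ n <= 6 * 7 ^ n.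
  by elim: (n) => // k IH; rewrite !expnS; nia.
have le67 : c * 6 ^ n <= 7 ^ n by nia.
have le189 : 27 ^ n * 7 ^ n <= 32 ^ n * 6 ^ n.
  by rewrite -!expnMn; case: (n) => // k; rewrite leq_exp2r.
have pos6 : 0 < 6 ^ n by rewrite expn_gt0.
by rewrite -(leq_pmul2r pos6) -mulnA mulnCA (leq_trans _ le189) // leq_mul2l le67 orbT.
Qed.

(** There are at most [2 ^ n] choices for the union [U]; each entry is then one of at most [2 ^ r]
    subsets of [U]. *)
Lemma card_bigcup_small (n t : nat) (r : nat) :
  #|[set a : {ffun 'I_t -> {set 'I_n}} | #|\bigcup_i a i| <= r]| <= 2 ^ n * (2 ^ r) ^ t.
Proof.
have -> : 2 ^ n * (2 ^ r) ^ t = \sum_(U : {set 'I_n}) (2 ^ r) ^ t.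
  by rewrite sum_nat_const card_sets_ord.
pose fits (U : {set 'I_n}) := [set a : {ffun 'I_t -> {set 'I_n}} |
  (#|U| <= r) && [forall i, a i \subset U]].
apply: (@leq_trans (\sum_U #|fits U|)); last first.
  apply: leq_sum => U _; case: (leqP #|U| r) => [le|gt]; last first.
    by rewrite (eq_card0 (A := fits U)) // => a; rewrite inE leqNgt gt.
  apply: (@leq_trans #|ffun_on_mem 'I_t (mem (powerset U))|).
    apply: subset_leq_card; apply/subsetP => a; rewrite inE => /andP[_ /forallP h].
    by apply/ffun_onP => i; rewrite inE.
  rewrite card_ffun_on card_powerset card_ord.
  by case: t {fits} => // t; rewrite leq_exp2r // leq_exp2l.
apply: (@leq_trans #|\bigcup_U fits U|); last first.
  elim/big_ind2: _ => [||U _] //; first by rewrite cards0.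
  by move=> x1 n1 x2 n2 h1 h2; apply: leq_trans (leq_add h1 h2); exact: (leq_card_setU _ _).1.
apply: subset_leq_card; apply/subsetP => a; rewrite inE => le.
apply/bigcupP; exists (\bigcup_i a i) => //; rewrite inE le.
by apply/forallP => i; apply: bigcup_sup.
Qed.

Definition disjointness (T : finType) : rel {set T} := fun A B => [disjoint A & B].

Lemma disjointness_sym (T : finType) : symmetric (@disjointness T).
Proof. by move=> A B; rewrite /disjointness disjoint_sym. Qed.

(* Replacing one vertex of a triangle by a 20-tuple: the union of the tuple rarely
   has at most [2n/5] elements, and otherwise the other two vertices are disjoint
   sets in a ground set of size [3n/5]; this is a gain because [3 ^ (3/5) < 2]. *)
Lemma triangles_pow20 (n : nat) (G : {set {set 'I_n}}) :
  triangles (@disjointness _) G ^ 20 <= (#|G| ^ 2) ^ 19 *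
    (#|G| ^ 2 * (2 ^ n * (2 ^ ((2 * n) %/ 5)) ^ 20) + #|G| ^ 20 * 3 ^ ((3 * n) %/ 5)).
Proof.
set m := #|G|; pose N := neighbours (@disjointness _) G.
pose D := [set p : {set 'I_n} * {set 'I_n} | (p.1 \in G) && (p.2 \in N p.1)].
have -> : triangles (@disjointness _) G = \sum_(p in D) #|N p.1 :&: N p.2|.
  rewrite /triangles /inner_edges pair_big_dep /=.
  by apply: eq_bigl => p; rewrite [RHS]inE.
have leD : #|D| <= m ^ 2.
  rewrite expnS expn1 -cardsX; apply: subset_leq_card; apply/subsetP => p.
  by rewrite !inE => /and3P[-> ->].
apply: leq_trans (blow_up _ _ _) _; apply: leq_mul; first by rewrite leq_exp2r.
set F := fun a : {ffun _ -> _} => _.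
pose small := [set a : {ffun 'I_20 -> {set 'I_n}} | #|\bigcup_i a i| <= (2 * n) %/ 5].
rewrite (bigID (mem small)) /=; apply: leq_add.
  apply: (@leq_trans (\sum_(a in small) m ^ 2)).
    apply: leq_sum => a _; apply: leq_trans leD; apply: subset_leq_card.
    by apply/subsetP => p; rewrite inE => /andP[].
  by rewrite sum_nat_const mulnC leq_mul2l card_bigcup_small orbT.
rewrite (bigID (fun a : {ffun 'I_20 -> {set 'I_n}} => a \in ffun_on (mem G))) /=.
rewrite [X in _ + X]big1 ?addn0; last first.
  move=> a /andP[_ /ffun_onP nG]; apply: eq_card0 => p; rewrite !inE.
  apply/negP => /andP[_ /forallP h]; apply: nG => i.
  by have := h i; rewrite !inE => /andP[/andP[]].
apply: (@leq_trans (\sum_(a | a \in ffun_on_mem 'I_20 (mem G)) 3 ^ ((3 * n) %/ 5))); last first.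
  by rewrite sum_nat_const card_ffun_on card_ord.
rewrite [X in _ <= X]big_mkcond [X in X <= _]big_mkcond; apply: leq_sum => a _.
case: ifP => // /andP[nsm ->]; rewrite inE -ltnNge in nsm.
set U := \bigcup_i a i in nsm.
apply: (@leq_trans (3 ^ #|~: U|)); last first.
  by rewrite leq_exp2l //; have := cardsC U; rewrite card_ord; lia.
apply: leq_trans (card_disjoint_pairs _); apply: subset_leq_card.
apply/subsetP => -[B C]; rewrite !inE /= => /andP[/and3P[BG CG dBC] /forallP h].
rewrite (dBC : [disjoint B & C]) andbT -!disjoints_subset; apply/andP; split; rewrite disjoint_sym;
  rewrite disjoints_subset; apply/bigcupsP => i _; rewrite -disjoints_subset disjoint_sym;
  by have := h i; rewrite !inE => /andP[/andP[_ d1] /andP[_ d2]].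
Qed.

(** [P] stands for [2 ^ n]. Tuples with small union cost [P * s <= P ^ 9] against
    [m ^ 20 >= P ^ 10 / 2 ^ 10], which is why 20 entries suffice; the others cost [u] against
    [m ^ 2 >= P / 2]. Each gain is at least [2 * K ^ 20], so each term takes at most half. *)
Lemma few_triangles_arith (K T m P s u : nat) :
  0 < m -> 2 ^ 11 * K ^ 20 <= P -> P <= 2 * m ^ 2 ->
  s <= P ^ 8 -> 4 * K ^ 20 * u <= P ->
  T ^ 20 <= (m ^ 2) ^ 19 * (m ^ 2 * (P * s) + m ^ 20 * u) ->
  K * T <= m ^ 3.
Proof.
move=> m_gt0 leP leG s_le u_le leT; rewrite -(leq_exp2r _ _ (isT : 0 < 20)) expnMn.
move: (K ^ 20) leP u_le => k leP u_le.
apply: (leq_trans (leq_mul (leqnn k) leT)).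
have -> : (m ^ 3) ^ 20 = (m ^ 2) ^ 19 * (m ^ 2 * m ^ 20) by rewrite -!expnM -!expnD.
rewrite mulnCA leq_mul2l; apply/orP; right.
have [c [c_gt0 leP' m20]] : exists c, [/\ 0 < c, c * (2 * k) <= P & P ^ 10 <= c * m ^ 20].
  exists (2 ^ 10); split; first by rewrite expn_gt0.
    by rewrite mulnA -expnSr.
  by rewrite (expnM m 2 10) -expnMn leq_exp2r.
have first : 2 * k * (P * s) <= m ^ 20.
  apply: (@leq_trans (2 * k * P ^ 9)).
    by rewrite leq_mul2l [P ^ 9]expnS leq_mul2l s_le !orbT.
  rewrite -(leq_pmul2l c_gt0); apply: leq_trans m20.
  by rewrite mulnA expnS leq_mul2r leP' orbT.
have second : 2 * k * u <= m ^ 2 by clear -u_le leG; move: (m ^ 2) leG => ? ?; lia.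
have f2 := leq_mul (leqnn (m ^ 2)) first.
have s2 := leq_mul (leqnn (m ^ 20)) second.
clear -f2 s2; move: (m ^ 2) (m ^ 20) (P * s) f2 s2 => m2 m20 Ps f2 s2.
by rewrite mulnDr; lia.
Qed.

Lemma few_triangles (K n : nat) (G : {set {set 'I_n}}) :
  6 * (4 * K ^ 20) ^ 5 <= n -> 2 ^ 11 * K ^ 20 <= n -> 2 ^ n <= 2 * #|G| ^ 2 ->
  K * triangles (@disjointness _) G <= #|G| ^ 3.
Proof.
move=> n_ge1 n_ge2 leG.
apply: few_triangles_arith (leG) _ _ (triangles_pow20 G).
- by rewrite lt0n; apply/eqP => m0; move: leG; rewrite m0 muln0 leqNgt expn_gt0.
- by apply: leq_trans n_ge2 _; apply/ltnW/ltn_expl.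
- by rewrite -!expnM leq_exp2l //; clear; lia.
(* Fifth powers clear the exponent [3n/5]: what remains compares [27 ^ n] with [32 ^ n]. *)
rewrite -(leq_exp2r _ _ (isT : 0 < 5)) expnMn.
have -> : (2 ^ n) ^ 5 = 32 ^ n by rewrite -expnM mulnC expnM.
apply: leq_trans (geometric_gap n_ge1).
have -> : 27 ^ n = 3 ^ (3 * n) by rewrite expnM.
by apply: leq_mul; [exact: leqnn | rewrite -expnM leq_exp2l //; clear; lia].
Qed.

(** * Families generated by disjoint unions *)

Definition generates (n : nat) (G Z : {set {set 'I_n}}) : Prop :=
  forall C, C \in Z -> exists A B, [/\ A \in G, B \in G, [disjoint A & B] & C = A :|: B].

Definition disjoint_pairs (n : nat) (X Y : {set {set 'I_n}}) :=
  [set p in setX X Y | [disjoint p.1 & p.2]].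

Lemma card_disjoint_pairs_inner (n : nat) (G X : {set {set 'I_n}}) :
  X \subset G -> #|disjoint_pairs X X| = inner_edges (@disjointness _) G X.
Proof.
move=> /subsetP sX; rewrite /inner_edges -card_pair_dep; apply: eq_card => -[A B].
rewrite !inE /= /disjointness; case: (boolP (B \in X)) => [/sX -> |]; last by rewrite !andbF.
by rewrite andbT.
Qed.

(** A generating pair has a member outside [X :|: Y], or both members in [X], or both in [Y], or one
    in each; only the last case is counted relative to [W]. *)
Lemma card_generated_split (n : nat) (G Z X Y W : {set {set 'I_n}}) :
  generates G Z -> X \subset G -> Y \subset G ->
  #|Z :&: W| <= #|G| * #|G :\: (X :|: Y)|
    + inner_edges (@disjointness _) G X + inner_edges (@disjointness _) G Y
    + #|[set p in disjoint_pairs X Y | p.1 :|: p.2 \in W]|.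
Proof.
move=> gen sX sY.
rewrite -(card_disjoint_pairs_inner sX) -(card_disjoint_pairs_inner sY) -cardsX.
pose un (p : {set 'I_n} * {set 'I_n}) := p.1 :|: p.2.
set P1 := setX _ _; set P2 := disjoint_pairs X X; set P3 := disjoint_pairs Y Y.
set P4 := [set _ in _ | _].
apply: (@leq_trans #|un @: P1 :|: un @: P2 :|: un @: P3 :|: un @: P4|); last first.
  apply: leq_trans (leq_card_setU _ _).1 _; apply: leq_add; last exact: leq_imset_card.
  apply: leq_trans (leq_card_setU _ _).1 _; apply: leq_add; last exact: leq_imset_card.
  by apply: leq_trans (leq_card_setU _ _).1 _; apply: leq_add; exact: leq_imset_card.
apply: subset_leq_card; apply/subsetP => C; rewrite inE => /andP[/gen[A [B [AG BG d eC]]] CW].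
have eC' : C = un (A, B) by [].
have eC'' : C = un (B, A) by rewrite /un setUC.
have d' : [disjoint B & A] by rewrite disjoint_sym.
rewrite !inE.
case: (boolP (A \in X :|: Y)) => [|Aout]; last first.
  apply/orP; left; apply/orP; left; apply/orP; left; rewrite eC''; apply: imset_f.
  by rewrite inE /= BG inE Aout AG.
case: (boolP (B \in X :|: Y)) => [|Bout]; last first.
  move=> _; apply/orP; left; apply/orP; left; apply/orP; left; rewrite eC'; apply: imset_f.
  by rewrite inE /= AG inE Bout BG.
rewrite !inE => /orP[] HB /orP[] HA.
- apply/orP; left; apply/orP; left; apply/orP; right; rewrite eC'; apply: imset_f.
  by rewrite !inE /= HA HB d.
- apply/orP; right; rewrite eC''; apply: imset_f.
  by rewrite !inE /= HA HB d' -/(un (B, A)) -eC'' CW.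
- apply/orP; right; rewrite eC'; apply: imset_f.
  by rewrite !inE /= HA HB d -/(un (A, B)) -eC' CW.
- apply/orP; left; apply/orP; right; rewrite eC'; apply: imset_f.
  by rewrite !inE /= HA HB d.
Qed.

(** A non-empty [C] comes from two distinct ordered pairs, [(A, B)] and [(B, A)]; the extra 2 pays
    for [set0], which may come from a single loop. *)
Lemma card_generated_edges (n : nat) (G Z : {set {set 'I_n}}) :
  generates G Z ->
  2 * #|Z| <= (\sum_(A in G) #|neighbours (@disjointness _) G A|).+2.
Proof.
move=> gen; rewrite -card_pair_dep; set D := [set p | _].
pose un (p : {set 'I_n} * {set 'I_n}) := p.1 :|: p.2.
have -> : #|D| = \sum_C #|[set p in D | un p == C]|.
  rewrite -sum1_card (partition_big un predT) //=; apply: eq_bigr => C _.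
  by rewrite -sum1_card; apply: eq_bigl => p; rewrite inE.
have le1 : #|Z| <= #|Z :\ set0|.+1 by rewrite (cardsD1 set0 Z); case: (_ \in _).
apply: (@leq_trans (#|Z :\ set0| * 2).+2); first by lia.
rewrite !ltnS -sum_nat_const big_mkcond; apply: leq_sum => C _.
case: ifP => //; rewrite in_setD1 => /andP[C0 /gen[A [B [AG BG d eC]]]].
have d' : [disjoint B & A] by rewrite disjoint_sym.
apply/card_gt1P; exists (A, B), (B, A); split.
- by rewrite !inE /un /= AG BG -eC eqxx /disjointness d.
- by rewrite !inE /un /= AG BG setUC -eC eqxx /disjointness d'.
apply: contra C0 => /eqP[eAB _]; rewrite eC eAB setUid.
by move: d; rewrite eAB -setI_eq0 setIid.
Qed.

(** * From a near bipartition to two cubes *)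

Lemma card_sets_containing (n : nat) (i : 'I_n) :
  2 ^ n = 2 * #|[set C : {set 'I_n} | i \in C]|.
Proof.
set W := [set C | _].
rewrite -card_sets_ord.
have eC : #|~: W| = #|W|.
  rewrite -[RHS](card_imset _ (@setC_inj _)); apply: eq_card => C.
  rewrite !inE; apply/idP/imsetP => [iC | [B]]; last by rewrite inE => iB ->; rewrite inE iB.
  by exists (~: C); rewrite ?setCK // !inE.
by rewrite -(cardsC W) eC mul2n addnn.
Qed.

Lemma card_disjoint_pairsC (n : nat) (X Y : {set {set 'I_n}}) :
  #|disjoint_pairs X Y| = #|disjoint_pairs Y X|.
Proof.
have h (V W : {set {set 'I_n}}) : #|disjoint_pairs V W| <= #|disjoint_pairs W V|.
  pose sw (p : {set 'I_n} * {set 'I_n}) := (p.2, p.1).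
  rewrite -(card_imset _ (f := sw)); last by move=> [? ?] [? ?] [-> ->].
  apply: subset_leq_card; apply/subsetP => _ /imsetP[p + ->].
  by rewrite !inE /= => /andP[/andP[-> ->]]; rewrite disjoint_sym.
by apply/eqP; rewrite eqn_leq !h.
Qed.

(** If [B] contains a frequent [i], it meets every member of [X] through [i], so it lies in at least
    [m / 32] non-disjoint pairs. *)
Lemma card_meeting_frequent (n m : nat) (X Y : {set {set 'I_n}}) :
  m * #|[set B in Y | ~~ [disjoint B & [set i | m <= 32 * #|[set A in X | i \in A]|]]]|
    <= 32 * (#|Y| * #|X| - #|disjoint_pairs Y X|).
Proof.
set S := [set i | _]; rewrite -cardsX.
have sub : disjoint_pairs Y X \subset setX Y X by apply/subsetP => p; rewrite inE => /andP[].
rewrite -[X in X - _](cardsID (disjoint_pairs Y X)) (setIidPr sub) addKn.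
have -> : #|setX Y X :\: disjoint_pairs Y X| =
    \sum_(B in Y) #|[set A in X | ~~ [disjoint B & A]]|.
  rewrite -card_pair_dep; apply: eq_card => -[B A]; rewrite !inE /=.
  by case: (B \in Y); case: (A \in X); rewrite ?andbF ?andbT.
rewrite mulnC -sum_nat_const big_distrr /= [X in X <= _]big_mkcond [X in _ <= X]big_mkcond.
apply: leq_sum => B _; rewrite inE; case: (B \in Y) => //=; case: ifP => //.
rewrite -setI_eq0 => /set0Pn[i]; rewrite !inE => /andP[iB le].
apply: (leq_trans le); rewrite leq_mul2l /=; apply: subset_leq_card.
apply/subsetP => A; rewrite !inE => /andP[-> iA] /=.
by rewrite -setI_eq0; apply/set0Pn; exists i; rewrite inE iB.
Qed.

(** The product bound forces [a] and [b] to be within 24/25 of [x = 2 ^ k] and [y = 2 ^ l], so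
    [x + y] is at most about [25 m / 24]. Unequal exponents differ by a factor 2 at least, which
    improves [(x + y) ^ 2 >= 4xy] to [9xy / 2], too much for [m ^ 2 <= 4.04 xy]. *)
Lemma balanced_exponents (k l m a b : nat) :
  1000 <= m -> a <= 2 ^ k -> b <= 2 ^ l -> a + b <= m.+1 ->
  24 * 2 ^ (k + l) <= 25 * (a * b) -> 100 * m ^ 2 <= 404 * 2 ^ (k + l) -> k = l.
Proof.
wlog le_kl : k l a b / k <= l.
  move=> H hm ha hb hab h1 h2; case/orP: (leq_total k l) => kl.
    exact: (H k l a b).
  by symmetry; apply: (H l k b a) => //; rewrite ?[b + a]addnC ?[l + k]addnC ?[b * a]mulnC.
move=> hm ha hb hab; rewrite expnD => h1 h2.
apply/eqP; rewrite eqn_leq le_kl /= leqNgt; apply/negP => lt.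
have le2 : 2 * 2 ^ k <= 2 ^ l by rewrite -expnS leq_exp2l.
have x0 : 0 < 2 ^ k by rewrite expn_gt0.
move: (2 ^ k) (2 ^ l) x0 le2 ha hb h1 h2 => x y x0 le2 ha hb h1 h2.
have ax : 24 * x <= 25 * a by nia.
have bY : 24 * y <= 25 * b by nia.
have sq : 9 * (x * y) <= 2 * (x + y) ^ 2 by nia.
have sq2 : 576 * (x + y) ^ 2 <= 625 * (m.+1) ^ 2.
  have : (24 * (x + y)) ^ 2 <= (25 * m.+1) ^ 2 by rewrite leq_exp2r //; lia.
  by rewrite !expnMn.
have sq3 : 1000 * m.+1 ^ 2 <= 1003 * m ^ 2 by nia.
have xy0 : 0 < x * y by nia.
by lia.
Qed.

(** AM-GM, with the square of [1 + 1/c] absorbed in [1 + 3/c]. *)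
Lemma near_partition_product (c m x y i : nat) :
  2 <= c -> c * i <= m -> x + y <= m + i -> c * (4 * (x * y)) <= (c + 3) * m ^ 2.
Proof.
move=> c_gt1 le_i le_xy.
have h1 : c * (x + y) <= c.+1 * m by nia.
have h2 : c ^ 2 * (x + y) ^ 2 <= c.+1 ^ 2 * m ^ 2 by rewrite -!expnMn leq_exp2r.
have amgm : 4 * (x * y) <= (x + y) ^ 2 := (nat_AGM2 x y).1.
have h3 : c ^ 2 * (4 * (x * y)) <= c.+1 ^ 2 * m ^ 2.
  by apply: leq_trans h2; rewrite leq_mul2l amgm orbT.
have : c * (c * (4 * (x * y))) <= c * ((c + 3) * m ^ 2).
  rewrite mulnA mulnn; apply: leq_trans h3 _; rewrite mulnA leq_mul2r.
  by apply/orP; right; clear -c_gt1; nia.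
by rewrite leq_pmul2l //; lia.
Qed.

Lemma near_bipartition_cubes (n c : nat) (G Z X Y : {set {set 'I_n}}) :
  let m := #|G| in
  generates G Z -> #|~: Z| <= m -> X \subset G -> Y \subset G ->
  100 * 300 <= c -> 100 * c <= m ->
  100 * c * m ^ 2 <= 4 * (100 * c + 1) * 2 ^ n -> 2 ^ n <= 2 * m ^ 2 ->
  c * (m * #|G :\: (X :|: Y)|) <= m ^ 2 -> c * (m * #|X :&: Y|) <= m ^ 2 ->
  c * (inner_edges (@disjointness _) G X + inner_edges (@disjointness _) G Y) <= m ^ 2 ->
  exists S : {set 'I_n}, #|S| = #|~: S| /\
    c * #|[set A in G | ~~ (A \subset S) && ~~ (A \subset ~: S)]| <= 200 * m.
Proof.
move=> m gen leZ sX sY c_ge m_ge Qle Ple outle intle inle.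
have m_gt0 : 0 < m by lia.
have cmQ : 100 * (c * m) <= m ^ 2 by rewrite mulnA -mulnn leq_mul2r m_ge orbT.
set P := 2 ^ n in Qle Ple.
have P_gt0 : 0 < P by rewrite expn_gt0.
have Q5 : 100 * m ^ 2 <= 404 * P.
  have : c * (100 * m ^ 2) <= c * (404 * P) by nia.
  by rewrite leq_pmul2l //; lia.
have Xm : #|X| <= m by apply: subset_leq_card.
have Ym : #|Y| <= m by apply: subset_leq_card.
pose p i := #|[set A in X | i \in A]|; pose q i := #|[set A in Y | i \in A]|.
pose S := [set i | m <= 32 * p i]; pose R := [set i | m <= 32 * q i].
pose bad := m * #|G :\: (X :|: Y)| + inner_edges (@disjointness _) G X
   + inner_edges (@disjointness _) G Y.
have cbad : c * bad <= 2 * m ^ 2 by rewrite /bad; lia.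
pose dis := #|disjoint_pairs X Y|.
have leW (W : {set {set 'I_n}}) :
    #|W| <= m + bad + #|[set p in disjoint_pairs X Y | p.1 :|: p.2 \in W]|.
  have := card_generated_split W gen sX sY; rewrite -/m -/bad => h.
  have h2 : #|W :\: Z| <= m.
    by apply: leq_trans leZ; apply: subset_leq_card; rewrite setDE subsetIr.
  by rewrite -(cardsID Z W) setIC; lia.
(* If [i] were infrequent in both, at most [m ^ 2 / 16] pairs would have a union through [i], while
   half of all sets, nearly [m ^ 2 / 8] at least, contain [i]. *)
have SR : S :|: R = setT.
  apply/setP => i; rewrite !inE; case: leqP => //= pi; case: leqP => //= qi; exfalso.
  pose W := [set C : {set 'I_n} | i \in C].
  have PW : P = 2 * #|W| := card_sets_containing i.
  have le : #|[set p in disjoint_pairs X Y | p.1 :|: p.2 \in W]| <= p i * #|Y| + #|X| * q i.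
    rewrite /p /q -!cardsX; apply: leq_trans (leq_card_setU _ _).1; apply: subset_leq_card.
    apply/subsetP => -[A B]; rewrite !inE /= => /andP[/andP[/andP[-> ->] _]].
    by rewrite !andbT.
  have := leW W; move: le cbad Q5 pi qi; rewrite PW in P_gt0 *; move: (#|W|) P_gt0 => w.
  move: (#|[set _ in _ | _]|) => d w0 le cbad Q5 pi qi lew.
  have h1 : 32 * (p i * #|Y|) <= m ^ 2 by rewrite -mulnn mulnA leq_mul // ltnW.
  have h2 : 32 * (#|X| * q i) <= m ^ 2 by rewrite -mulnn mulnCA leq_mul // ltnW.
  have h3 : c * (16 * w) <= c * (16 * m + 16 * bad + m ^ 2) by rewrite leq_mul2l; lia.
  have h4 : c * (100 * m ^ 2) <= c * (404 * (2 * w)) by rewrite leq_mul2l Q5 orbT.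
  have h5 : 100 * 300 * w <= c * w by rewrite leq_mul2r c_ge orbT.
  by lia.
pose ND := #|X| * #|Y| - dis.
have XY : #|X| * #|Y| = dis + ND.
  rewrite /ND subnKC // /dis -cardsX; apply: subset_leq_card.
  by apply/subsetP => r; rewrite inE => /andP[].
have lePdis : P <= m + bad + dis.
  have := leW setT; rewrite cardsT card_sets_ord => /leq_trans; apply; rewrite leq_add2l.
  by apply: subset_leq_card; apply/subsetP => r; rewrite inE => /andP[].
(* [#|X| * #|Y|] hardly exceeds [m ^ 2 / 4], and the disjoint pairs already number nearly [2 ^ n],
   hence nearly [m ^ 2 / 4]. *)
have cND : c * ND <= 3 * m ^ 2.
  have int' : c * #|X :&: Y| <= m.
    have : m * (c * #|X :&: Y|) <= m * m by rewrite mulnn; lia.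
    by rewrite leq_pmul2l.
  have sumXY : #|X| + #|Y| <= m + #|X :&: Y|.
    by rewrite -cardsUI leq_add2r; apply: subset_leq_card; rewrite subUset sX sY.
  have h4 : c * (4 * (#|X| * #|Y|)) <= (c + 3) * m ^ 2.
    by apply: near_partition_product int' sumXY; lia.
  rewrite XY in h4.
  have h6 : c * P <= c * (m + bad + dis) by rewrite leq_mul2l lePdis orbT.
  by lia.
have meet_div (V : {set {set 'I_n}}) : m * #|V| <= 32 * ND -> c * #|V| <= 96 * m.
  move=> h; have : m * (c * #|V|) <= m * (96 * m).
    rewrite mulnCA; apply: leq_trans (leq_mul (leqnn c) h) _.
    by rewrite [m * _]mulnCA mulnn; lia.
  by rewrite leq_pmul2l.
pose YS := [set B in Y | ~~ [disjoint B & S]]; pose XR := [set A in X | ~~ [disjoint A & R]].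
have cYS : c * #|YS| <= 96 * m.
  apply: meet_div; rewrite /ND mulnC; have := card_meeting_frequent m X Y.
  by rewrite card_disjoint_pairsC [#|Y| * #|X|]mulnC [X in _ -> X <= _]mulnC.
have cXR : c * #|XR| <= 96 * m by apply: meet_div; exact: card_meeting_frequent.
have inS A : A \in X -> A \notin XR -> A \subset S.
  rewrite inE => -> /= /negPn; rewrite disjoints_subset => /subset_trans; apply.
  by apply/subsetP => i; have := in_setT i; rewrite -SR !inE; case: (m <= 32 * q i); rewrite ?orbF.
have inSC B : B \in Y -> B \notin YS -> B \subset ~: S.
  by rewrite inE => -> /= /negPn; rewrite disjoints_subset.
exists S; split; last first.
  set U := [set A in G | _].
  have : #|U| <= #|G :\: (X :|: Y)| + #|XR| + #|YS|.
    apply: leq_trans (leq_add (leq_card_setU _ _).1 (leqnn _)).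
    apply: leq_trans (leq_card_setU _ _).1; apply: subset_leq_card.
    apply/subsetP => A; rewrite inE => /and3P[AG nS nSC].
    rewrite in_setU in_setU in_setD in_setU AG andbT.
    case: (boolP (A \in X)) => /= [AX|_].
      by case: (boolP (A \in XR)) => //= /(inS _ AX); rewrite (negPf nS).
    case: (boolP (A \in Y)) => //= AY.
    by case: (boolP (A \in YS)) => //= [|/(inSC _ AY)]; rewrite ?orbT // (negPf nSC).
  have out' : c * #|G :\: (X :|: Y)| <= m.
    have : m * (c * #|G :\: (X :|: Y)|) <= m * m by rewrite mulnn; lia.
    by rewrite leq_pmul2l.
  by move=> /(leq_mul (leqnn c)); rewrite !mulnDr; lia.
pose Ga := [set A in G | A \subset S]; pose Gb := [set A in G | A \subset ~: S].
(* Apart from the exceptional sets in [XR] and [YS], a disjoint pair has one member below [S] and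
   the other below its complement. *)
have disle : dis <= #|XR| * #|Y| + #|X| * #|YS| + #|Ga| * #|Gb|.
  rewrite -!cardsX; apply: leq_trans (leq_add (leq_card_setU _ _).1 (leqnn _)).
  apply: leq_trans (leq_card_setU _ _).1; apply: subset_leq_card.
  apply/subsetP => -[A B]; rewrite in_set in_setX /= => /andP[/andP[AX BY] _].
  rewrite !in_setU !in_setX /= AX BY andbT /=.
  case: (boolP (A \in XR)) => //= /(inS _ AX) AS.
  case: (boolP (B \in YS)) => //= /(inSC _ BY) BS.
  by rewrite !inE AS BS (subsetP sX _ AX) (subsetP sY _ BY).
have nE : n = #|S| + #|~: S| by rewrite cardsC card_ord.
apply: (@balanced_exponents _ _ m #|Ga| #|Gb|); rewrite -?nE -/P //.
- by lia.
- by rewrite -card_powerset; apply: subset_leq_card; apply/subsetP => A; rewrite !inE => /andP[].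
- by rewrite -card_powerset; apply: subset_leq_card; apply/subsetP => A; rewrite !inE => /andP[].
(* The extra 1 is for [set0], the only set below both [S] and its complement. *)
- rewrite -cardsUI -addn1; apply: leq_add.
    by apply: subset_leq_card; apply/subsetP => A; rewrite !inE => /orP[] /andP[].
  rewrite -(cards1 (set0 : {set 'I_n})); apply: subset_leq_card; apply/subsetP => A.
  rewrite !inE => /andP[/andP[_ AS] /andP[_ AC]].
  by rewrite -subset0 -(setICr S) subsetI AS AC.
have h1 : c * (#|XR| * #|Y|) <= 96 * m ^ 2 by rewrite -mulnn !mulnA leq_mul.
have h2 : c * (#|X| * #|YS|) <= 96 * m ^ 2.
  by rewrite [#|X| * _]mulnC -mulnn !mulnA leq_mul.
have h3 : c * P <= c * (m + bad + (#|XR| * #|Y| + #|X| * #|YS| + #|Ga| * #|Gb|)).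
  by rewrite leq_mul2l; lia.
have h4 : c * (24 * P) <= c * (25 * (#|Ga| * #|Gb|)).
  have h5 : 100 * 300 * P <= c * P by rewrite leq_mul2r c_ge orbT.
  by move: (#|Ga| * #|Gb|) h3 => ab h3; lia.
by move: h4; rewrite leq_pmul2l //; lia.
Qed.

(** * Existence of the spanning edge and its near bipartition *)

(** [E] is nearly [2 * P], so [m ^ 2 - 2 * E] is at most [0.14 * m ^ 2 / c]; this deficit costs
    [0.14 * m ^ 2 * E] and the triangles cost [0.1 * m ^ 2 * E], leaving slack. *)
Lemma spanning_edge_arith (c m P E T : nat) :
  0 < c -> 100 * c <= m -> 100 * c * m ^ 2 <= 4 * (100 * c + 1) * P ->
  P <= 2 * m ^ 2 -> 2 * P <= E + 3 * m -> 100 * c * T <= m ^ 3 ->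
  c * (4 * (m * T)) + c * (m ^ 2 * E) < c * (2 * E ^ 2) + m ^ 2 * E.
Proof.
move=> c_gt0 cm QP PQ PE Tle.
have mQ : 100 * (c * m) <= m ^ 2 by rewrite mulnA -mulnn leq_mul2r cm orbT.
have cPE : c * (2 * P) <= c * (E + 3 * m) by rewrite leq_mul2l PE orbT.
have QE : 100 * (c * m ^ 2) <= 200 * (c * E) + 14 * m ^ 2 by lia.
have mT : 100 * (c * (m * T)) <= m ^ 2 * m ^ 2.
  have : m * (100 * c * T) <= m * m ^ 3 by rewrite leq_mul2l Tle orbT.
  by rewrite -expnS -expnD; lia.
have Q_gt0 : 0 < m ^ 2 by rewrite expn_gt0; apply/orP; left; lia.
have EQ : 2 * m ^ 2 <= 5 * E.
  have : c * (2 * m ^ 2) <= c * (5 * E).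
    have : m ^ 2 <= c * m ^ 2 by rewrite leq_pmull.
    by lia.
  by rewrite leq_pmul2l.
have QEE : 100 * (c * m ^ 2) * E <= (200 * (c * E) + 14 * m ^ 2) * E by rewrite leq_mul2r QE orbT.
have QQ : m ^ 2 * (2 * m ^ 2) <= m ^ 2 * (5 * E) by rewrite leq_mul2l EQ orbT.
have QQ0 : 0 < m ^ 2 * m ^ 2 by rewrite muln_gt0 Q_gt0.
clear -QEE QQ QQ0 mT; rewrite -[E ^ 2]mulnn.
by move: (m ^ 2) QEE QQ QQ0 mT => Q; lia.
Qed.

Lemma small_generator_cubes (n c : nat) (G Z : {set {set 'I_n}}) :
  generates G Z -> #|~: Z| <= #|G| -> 100 * 300 <= c ->
  6 * (4 * (100 * c) ^ 20) ^ 5 <= n -> 2 ^ 11 * (100 * c) ^ 20 <= n ->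
  100 * c + (100 * c) ^ 2 <= n ->
  100 * c * #|G| ^ 2 <= 4 * (100 * c + 1) * 2 ^ n ->
  100 * c <= #|G| /\
  exists S : {set 'I_n}, #|S| = #|~: S| /\
    c * #|[set A in G | ~~ (A \subset S) && ~~ (A \subset ~: S)]| <= 200 * #|G|.
Proof.
move=> gen leZ c_ge n_ge1 n_ge2 n_ge3 QP.
pose N := neighbours (@disjointness _) G.
have ltn : n < 2 ^ n by apply: ltn_expl.
(* The split with [X = G] and [Y] empty gives this crude bound, which forces [#|G|] to be large. *)
have Pm : 2 ^ n <= #|G| + #|G| ^ 2.
  have := card_generated_split setT gen (subxx G) (sub0set G).
  rewrite setIT setU0 setDv cards0 muln0 add0n.
  have -> : inner_edges (@disjointness _) G set0 = 0 by rewrite /inner_edges big_set0.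
  have -> : [set p in disjoint_pairs G set0 | p.1 :|: p.2 \in setT] = set0.
    by apply/setP => p; rewrite !inE !andbF.
  rewrite cards0 !addn0 -(card_disjoint_pairs_inner (subxx G)) => le.
  have leG : #|disjoint_pairs G G| <= #|G| ^ 2.
    by rewrite -mulnn -cardsX; apply: subset_leq_card; apply/subsetP => p; rewrite inE => /andP[].
  by rewrite -card_sets_ord -(cardsC Z) addnC; apply: leq_add => //; apply: leq_trans leG.
have cm : 100 * c <= #|G|.
  rewrite leqNgt; apply/negP => lt.
  have : #|G| + #|G| ^ 2 <= 100 * c + (100 * c) ^ 2.
    by apply: leq_add; [exact: ltnW | rewrite leq_exp2r // ltnW].
  move: n_ge3 Pm ltn; clear; move: (#|G| + _) (2 ^ n) (100 * c + _) => ? ? ?; lia.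
have PQ : 2 ^ n <= 2 * #|G| ^ 2.
  apply: (leq_trans Pm); rewrite mul2n -addnn leq_add2r -mulnn leq_pmulr //.
  by clear -cm c_ge; lia.
have Tle := few_triangles n_ge1 n_ge2 PQ.
clear n_ge1 n_ge2 n_ge3.
have PE : 2 * 2 ^ n <= \sum_(A in G) #|N A| + 3 * #|G|.
  have := card_generated_edges gen; rewrite -/N -card_sets_ord -(cardsC Z).
  by move: (\sum_(A in G) _) => E; clear -leZ cm c_ge; lia.
split=> //.
have c_gt0 : 0 < c by clear -c_ge; lia.
have := spanning_edge_arith c_gt0 cm QP PQ PE Tle.
case/(exists_spanning_edge (@disjointness_sym _)) => A [B [AG BN]].
rewrite -/N; move=> edge.
have sN D : N D \subset G by apply/subsetP => C; rewrite inE => /andP[].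
have outE : #|G| = #|N A :|: N B| + #|G :\: (N A :|: N B)|.
  by rewrite -(cardsID (N A :|: N B) G) (setIidPr _) // subUset !sN.
have UI := cardsUI (N A) (N B).
(* Writing one factor of [m ^ 2] as union plus rest cancels the union and bounds all three errors at
   once. *)
have key : c * (#|G| * #|G :\: (N A :|: N B)|) + c * (#|G| * #|N A :&: N B|) +
    c * (inner_edges (@disjointness _) G (N A) + inner_edges (@disjointness _) G (N B))
    <= #|G| ^ 2.
  move: edge; rewrite -UI.
  have -> : c * #|G| ^ 2 = c * (#|G| * (#|N A :|: N B| + #|G :\: (N A :|: N B)|)).
    by rewrite -outE mulnn.
  clear; move: (#|G| ^ 2) #|G :\: _| #|N A :|: N B| #|N A :&: N B|
    (inner_edges _ _ (N A)) (inner_edges _ _ (N B)) #|G|; lia.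
by apply: (near_bipartition_cubes gen leZ (sN A) (sN B) c_ge cm QP PQ);
  apply: leq_trans key; rewrite ?leq_addl // -addnA ?leq_addr // addnCA leq_addr.
Qed.

(** * Structure of maximal 3-wise intersecting families *)

(** Otherwise [C] could be added: a subfamily containing [C] has at most two other members, and a
    missing one is replaced by a repetition or by any member of [F]. *)
Lemma maximal_3wise_blocked (n : nat) (F : {set {set 'I_n}}) (C : {set 'I_n}) :
  0 < n -> maximal_kwise_intersecting 3 F -> C \notin F ->
  exists A B, [/\ A \in F, B \in F & C :&: A :&: B = set0].
Proof.
move=> n_gt0 [kF maxF] CF.
have [D DF] : exists D, D \in F.
  apply/set0Pn/eqP => F0; apply: (maxF setT); first by rewrite F0 inE.
  move=> G; rewrite F0 setU0 => /subsetP sG _; exists (Ordinal n_gt0) => A /sG.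
  by rewrite inE => /eqP ->; rewrite inE.
case: (boolP [exists A in F, exists B in F, C :&: A :&: B == set0]) => [|none].
  by case/exists_inP => A AF /exists_inP[B BF /eqP]; exists A, B.
case: (maxF C CF) => G sG cG.
have meet A B : A \in F -> B \in F -> exists x, x \in C :&: A :&: B.
  move=> AF BF; apply/set0Pn; apply: contra none => e.
  by apply/exists_inP; exists A => //; apply/exists_inP; exists B.
case: (boolP (C \in G)) => CG; last first.
  apply: kF => //; apply/subsetP => A AG; have := subsetP sG A AG; rewrite !inE.
  by case: eqP AG CG => // -> ->.
have sub A : A \in G :\ C -> A \in F.
  by rewrite !inE => /andP[neAC /(subsetP sG)]; rewrite !inE (negPf neAC).
have : #|G :\ C| <= 2 by case/andP: cG => _; rewrite (cardsD1 C G) CG.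
rewrite leq_eqVlt => /orP[/cards2P[A [B [_ e]]] | ].
  have AF : A \in F by apply: sub; rewrite e !inE eqxx.
  have BF : B \in F by apply: sub; rewrite e !inE eqxx orbT.
  have [x] := meet A B AF BF; rewrite !inE => /andP[/andP[xC xA] xB]; exists x => E EG.
  have [-> //|EC] := eqVneq E C.
  have : E \in G :\ C by rewrite !inE EC EG.
  by rewrite e !inE => /orP[] /eqP ->.
rewrite ltnS leq_eqVlt => /orP[/cards1P[A e] | ].
  have AF : A \in F by apply: sub; rewrite e inE.
  have [x] := meet A A AF AF; rewrite !inE => /andP[/andP[xC xA] _]; exists x => E EG.
  have [-> //|EC] := eqVneq E C.
  have : E \in G :\ C by rewrite !inE EC EG.
  by rewrite e !inE => /eqP ->.
rewrite ltnS leqn0 cards_eq0 => /eqP e.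
have [x] := meet D D DF DF; rewrite !inE => /andP[/andP[xC _] _]; exists x => E EG.
have [-> //|EC] := eqVneq E C.
have : E \in G :\ C by rewrite !inE EC EG.
by rewrite e inE.
Qed.

Lemma maximal_3wise_upset (n : nat) (F : {set {set 'I_n}}) (A B : {set 'I_n}) :
  0 < n -> maximal_kwise_intersecting 3 F -> A \in F -> A \subset B -> B \in F.
Proof.
move=> n_gt0 maxF AF sAB; apply/negPn/negP => BF.
have [C [D [CF DF e]]] := maximal_3wise_blocked n_gt0 maxF BF.
have [| |x h] := maxF.1 [set A; C; D].
- by apply/subsetP => E; rewrite !inE => /orP[/orP[]|] /eqP ->.
- rewrite card_gt0; apply/andP; split; first by apply/set0Pn; exists A; rewrite !inE eqxx.
  apply: leq_trans (leq_card_setU _ _).1 _; rewrite cards1 cards2.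
  by case: (_ != _).
have := in_set0 x; rewrite -e !inE (subsetP sAB) ?h ?inE ?eqxx ?orbT //.
Qed.

(** If [A] and [B] block [C], split [C] along [A]: the complement of [C :\: A] contains [A], that of
    [C :&: A] contains [B], and [F] is an up-set. *)
Lemma maximal_3wise_generates (n : nat) (F : {set {set 'I_n}}) :
  0 < n -> maximal_kwise_intersecting 3 F ->
  generates [set ~: A | A in F] (~: F).
Proof.
move=> n_gt0 maxF C; rewrite inE => CF.
have [A [B [AF BF e]]] := maximal_3wise_blocked n_gt0 maxF CF.
have up := maximal_3wise_upset n_gt0 maxF.
exists (C :\: A), (C :&: A); split.
- by apply/imsetP; exists (~: (C :\: A)); rewrite ?setCK //; apply: up AF _;
    rewrite setDE setCI setCK subsetUr.
- apply/imsetP; exists (~: (C :&: A)); rewrite ?setCK //; apply: up BF _.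
  by rewrite -disjoints_subset -setI_eq0 setIC e.
- by rewrite disjoints_subset; apply/subsetP => x;
    rewrite !inE => /andP[/negPf -> _]; rewrite andbF.
- by rewrite setUC setID.
Qed.

(** * Return to linked cubes and choice of constants *)

(** Complementation exchanges supersets of [S] and subsets of [~: S]; the extra 2 pays for [S] and
    [~: S], which proper inclusion may leave out. *)
Lemma card_minus_linked_cubes (n : nat) (F : {set {set 'I_n}}) (S : {set 'I_n}) :
  #|F :\: linked_cubes S| <=
  #|[set A in [set ~: A | A in F] | ~~ (A \subset S) && ~~ (A \subset ~: S)]| + 2.
Proof.
set U := [set A in _ | _].
have -> : #|U| = #|[set ~: A | A in U]| by rewrite card_imset //; exact: setC_inj.
apply: (@leq_trans #|[set ~: A | A in U] :|: [set S; ~: S]|); last first.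
  apply: leq_trans (leq_card_setU _ _).1 _; rewrite leq_add2l cards2; by case: (_ != _).
apply: subset_leq_card; apply/subsetP => A; rewrite !inE => /andP[nL AF].
have [->|AS] := eqVneq A S; first by rewrite orbT.
have [->|ASC] := eqVneq A (~: S); first by rewrite !orbT.
rewrite !orbF; apply/imsetP; exists (~: A); last by rewrite setCK.
move: nL; rewrite !properEneq negb_or ![_ == A]eq_sym AS ASC /= => /andP[h1 h2].
rewrite inE; apply/andP; split; first by apply/imsetP; exists A.
by rewrite -setCS setCK h2 setCS h1.
Qed.

Lemma pow_INR_two (n : nat) : INR (2 ^ n) = (2 ^ n)%R.
Proof. by elim: n => // n IH; rewrite expnS mult_INR IH. Qed.

Theorem theorem1p2 :
  forall eps : R, (0 < eps)%R ->
  exists eta : R, (0 < eta)%R /\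
  exists N : nat, forall n : nat, (N <= n)%N ->
  forall F : {set {set 'I_n}},
    maximal_kwise_intersecting 3 F ->
    (INR #|F| <= (1 + eta) * Rpower 2 ((INR n + 2) / 2))%R ->
    ~~ odd n /\
    exists S : {set 'I_n}, balanced S /\
      (INR #|F :\: linked_cubes S| <= eps * INR #|F|)%R.
Proof.
move=> eps eps_gt0.
have [L L_gt0 epsL] : exists2 L : nat, 0 < L & (1 <= eps * INR L)%R.
  have [L [h /ltP L0]] := archimed_cor1 eps eps_gt0; exists L => //.
  have L1 : (0 < INR L)%R by apply: lt_0_INR; apply/ltP.
  apply: (Rmult_le_reg_r (/ INR L)); first exact: Rinv_0_lt_compat.
  by rewrite Rmult_assoc Rinv_r ?Rmult_1_l ?Rmult_1_r; lra.
(* With [400 * L <= c], the exceptional sets number at most [m / (2 * L)], and the two extra sets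
   fit in the other half. *)
have [c [c_ge cL]] : exists c, 100 * 300 <= c /\ 400 * L <= c.
  by exists (100 * 300 + 400 * L); rewrite leq_addr leq_addl.
have [K KE] : exists K, 100 * c = K by exists (100 * c).
have K_gt0 : 0 < K by clear -KE c_ge; lia.
have rK_gt0 : (0 < INR K)%R by apply: lt_0_INR; apply/ltP.
(* Chosen so that [(1 + eta) ^ 2 <= 1 + 1 / K]. *)
exists (/ (3 * INR K))%R; split; first by apply: Rinv_0_lt_compat; lra.
(* The first two summands make triangles rare; the last forces the family to have at least [K]
   members. *)
exists (6 * (4 * K ^ 20) ^ 5 + (2 ^ 11 * K ^ 20 + (K + K ^ 2))) => n n_ge F maxF leF.
have n_ge1 : 6 * (4 * K ^ 20) ^ 5 <= n by apply: leq_trans n_ge; exact: leq_addr.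
have n_ge2 : 2 ^ 11 * K ^ 20 <= n.
  by apply: leq_trans n_ge; rewrite addnCA; exact: leq_addr.
have n_ge3 : K + K ^ 2 <= n by apply: leq_trans n_ge; rewrite addnA; exact: leq_addl.
clear n_ge.
have n_gt0 : 0 < n.
  by apply: leq_trans n_ge3; rewrite addn_gt0 K_gt0.
pose G := [set ~: A | A in F].
have cardG : #|G| = #|F| by rewrite card_imset //; exact: setC_inj.
have QP : K * #|G| ^ 2 <= 4 * (K + 1) * 2 ^ n.
  apply/leP/INR_le; rewrite cardG -mulnn.
  rewrite !mult_INR plus_INR pow_INR_two /=.
  have rho_gt0 : (0 < Rpower 2 ((INR n + 2) / 2))%R by exact: exp_pos.
  have rho2 : (Rpower 2 ((INR n + 2) / 2) * Rpower 2 ((INR n + 2) / 2) = 4 * 2 ^ n)%R.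
    rewrite -Rpower_plus.
    have -> : ((INR n + 2) / 2 + (INR n + 2) / 2 = INR n + INR 2)%R by rewrite /=; field.
    by rewrite Rpower_plus !Rpower_pow; [rewrite /=; ring | lra..].
  move: (Rpower _ _) rho_gt0 rho2 leF => rho rho_gt0 rho2 leF.
  have f0 := pos_INR #|F|; move: (INR #|F|) f0 leF => f f0 leF.
  have ff : (f * f <= (1 + / (3 * INR K)) * (1 + / (3 * INR K)) * (4 * 2 ^ n))%R.
    by rewrite -rho2; nra.
  have key : (INR K * ((1 + / (3 * INR K)) * (1 + / (3 * INR K))) <= INR K + 1)%R.
    have inv : (INR K * / (3 * INR K) = / 3)%R by field; lra.
    have inv_le : (/ (3 * INR K) <= 1)%R.
      rewrite -Rinv_1; apply: Rinv_le_contravar; first lra.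
      by have := le_INR 1 K (leP K_gt0); rewrite /=; lra.
    nra.
  have := pow_lt 2 n ltac:(lra); nra.
have gen := maximal_3wise_generates n_gt0 maxF.
have leZ : #|~: (~: F)| <= #|G| by rewrite setCK cardG.
have := @small_generator_cubes n c G _ gen leZ c_ge; rewrite KE.
move=> /(_ n_ge1 n_ge2 n_ge3 QP)[Km [S [cardS small]]].
have nE : n = #|S| + #|S| by rewrite {2}cardS cardsC card_ord.
split; first by rewrite nE addnn odd_double.
exists S; split.
  by rewrite /balanced; move: #|S| nE => k ->; rewrite addnn doubleK uphalf_double leqnn.
have := card_minus_linked_cubes F S; rewrite -/G => le.
have : L * #|F :\: linked_cubes S| <= #|F|.
  rewrite -cardG; move: small le; move: #|[set _ in _ | _]| => u.
  move: #|_ :\: _| #|G| Km => d m Km; clear -KE Km cL L_gt0; nia.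
move=> /leP/le_INR; rewrite mult_INR => h.
have := Rmult_le_compat_l eps _ _ (Rlt_le _ _ eps_gt0) h.
have := pos_INR #|F :\: linked_cubes S|.
by nra.
Qed.
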